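(* Let $k$ be a field, let $H$ be a finite-dimensional Hopf algebra over $k$ with antipode $S_H$, and let $\Lambda \in H$ be a non-zero left integral. Then $S_H^2(\Lambda) = \nu_{-1}(H)\,\Lambda$.
   Context: For a finite-dimensional Hopf algebra $H$ with antipode $S_H$ and any $n \in \mathbb{Z}$, $\nu_n(H) = \mathrm{Tr}(S_H \circ P_H^{(n-1)}: H \to H) \in k$, where $P_H^{(m)}$ ($m \in \mathbb{Z}$) is the $m$-th power of $\mathrm{id}_H$ in the convolution algebra $\mathrm{End}_k(H)$. In particular $P_H^{(-2)}(h) = S_H(h_{(1)})S_H(h_{(2)})$ and $\nu_{-1}(H) = \mathrm{Tr}(S_H \circ P_H^{(-2)})$. A left integral in $H$ is an element $\Lambda$ with $h\Lambda = \varepsilon(h)\Lambda$ for all $h \in H$. *)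

(* Defs.v *)
From HB Require Import structures.
From mathcomp Require Import all_boot all_order all_algebra all_field.

Set Implicit Arguments.
Unset Strict Implicit.
Unset Printing Implicit Defensive.

Import GRing.Theory.
Local Open Scope ring_scope.

(* The tensor product of two finite-dimensional vector spaces is modelled by  *)
(* matrices of coordinates: A stands for \sum_(i, j) A i j (e_i (x) e_j),     *)
(* where (e_i) and (e_j) are the bases vbasis {:U} and vbasis {:V}.           *)
(* The lemmas tlift_tens and linear_tlift below give its universal property:  *)
(* the theory never refers to the bases again.                                *)
Section TensorProduct.
Variable k : fieldType.

Definition tensor (U V : vectType k) := 'M[k]_(\dim {:U}, \dim {:V}).
HB.instance Definition _ U V := Vector.on (tensor U V).

Definition tens (U V : vectType k) (u : U) (v : V) : tensor U V :=
  \matrix_(i, j) (coord (vbasis {:U}) i u * coord (vbasis {:V}) j v).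

(* The linear map on tensor U V induced by a bilinear f. In Sweedler notation *)
(* tlift f (comul h) is f h_(1) h_(2).                                        *)
Definition tlift (U V : vectType k) (W : lmodType k) (f : U -> V -> W)
    (t : tensor U V) : W :=
  \sum_i \sum_j t i j *: f (vbasis {:U})`_i (vbasis {:V})`_j.

Definition tmap (U V U' V' : vectType k) (f : U -> U') (g : V -> V') :
    tensor U V -> tensor U' V' :=
  tlift (fun u v => tens (f u) (g v)).

Definition tassoc (U V W : vectType k) :
    tensor (tensor U V) W -> tensor U (tensor V W) :=
  tlift (fun s w => tlift (fun u v => tens u (tens v w)) s).

Definition tmul (A B : falgType k) (s t : tensor A B) : tensor A B :=
  tlift (fun a b => tlift (fun a' b' => tens (a * a') (b * b')) t) s.

Lemma tlift_is_linear (U V : vectType k) (W : lmodType k) (f : U -> V -> W) :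
  linear (tlift f).
Proof.
move=> a s t; rewrite /tlift scaler_sumr -big_split; apply: eq_bigr => i _ /=.
rewrite scaler_sumr -big_split; apply: eq_bigr => j _ /=.
by rewrite !mxE scalerDl scalerA.
Qed.

Lemma eq_tlift (U V : vectType k) (W : lmodType k) (f g : U -> V -> W) :
  f =2 g -> tlift f =1 tlift g.
Proof. by move=> fg t; do 2!apply: eq_bigr => ? _; rewrite fg. Qed.

Lemma tlift_tens (U V : vectType k) (W : lmodType k) (f : U -> V -> W) u v :
    (forall y, linear (f^~ y)) -> (forall x, linear (f x)) ->
  tlift f (tens u v) = f u v.
Proof.
move=> fl fr; rewrite /tlift.
pose F y := GRing.isLinear.Build k U W *:%R (f^~ y) (fl y).
pose Fl y : {linear U -> W} := HB.pack (f^~ y) (F y).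
pose G x := GRing.isLinear.Build k V W *:%R (f x) (fr x).
pose Fr x : {linear V -> W} := HB.pack (f x) (G x).
rewrite [u in RHS](coord_vbasis (memvf u)).
transitivity (Fl v (\sum_i coord (vbasis {:U}) i u *: (vbasis {:U})`_i)) => //.
rewrite linear_sum; apply: eq_bigr => i _; rewrite linearZ /=.
rewrite [v in RHS](coord_vbasis (memvf v)).
transitivity (coord (vbasis {:U}) i u *: Fr (vbasis {:U})`_i
   (\sum_j coord (vbasis {:V}) j v *: (vbasis {:V})`_j)) => //.
rewrite linear_sum scaler_sumr; apply: eq_bigr => j _.
by rewrite linearZ /= scalerA mxE.
Qed.

Lemma linear_tlift (U V : vectType k) (W W' : lmodType k)
    (T : {linear W -> W'}) (f : U -> V -> W) t :
  T (tlift f t) = tlift (fun u v => T (f u v)) t.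
Proof.
rewrite linear_sum; apply: eq_bigr => i _; rewrite linear_sum.
by apply: eq_bigr => j _; rewrite linearZ.
Qed.

Lemma tens_is_linearl (U V : vectType k) (v : V) :
  linear (fun u : U => tens u v).
Proof.
by move=> a x y; apply/matrixP=> i j; rewrite !mxE linearP /= mulrDl mulrA.
Qed.

Lemma tens_is_linearr (U V : vectType k) (u : U) : linear (@tens U V u).
Proof.
by move=> a x y; apply/matrixP=> i j; rewrite !mxE linearP /= mulrDr mulrCA.
Qed.

End TensorProduct.

HB.instance Definition _ (k : fieldType) (U V : vectType k) (W : lmodType k)
    (f : U -> V -> W) :=
  GRing.isLinear.Build k (tensor U V) W *:%R (tlift f) (tlift_is_linear f).

Lemma tassoc_tens (k : fieldType) (U V W : vectType k)
    (s : tensor U V) (w : W) :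
  tassoc (tens s w) = tlift (fun u v => tens u (tens v w)) s.
Proof.
rewrite /tassoc tlift_tens // => [y|x]; first exact: tlift_is_linear.
move=> a u v; rewrite /tlift scaler_sumr -big_split; apply: eq_bigr => i _.
rewrite scaler_sumr -big_split; apply: eq_bigr => j _ /=.
by rewrite !tens_is_linearr scalerDr !scalerA mulrC.
Qed.

(* An falgType is a finite-dimensional unital associative algebra (with       *)
(* 1 != 0, which counit1 forces anyway).                                       *)
Record hopfType (k : fieldType) := HopfType {
  hopf_alg :> falgType k;
  comul : 'Hom(hopf_alg, tensor hopf_alg hopf_alg);
  counit : {scalar hopf_alg};
  antipode : 'End(hopf_alg);
  comulA : forall h,
    tassoc (tmap comul id (comul h)) = tmap id comul (comul h);
  comul_counitl : forall h, tlift (fun x y => counit x *: y) (comul h) = h;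
  comul_counitr : forall h, tlift (fun x y => counit y *: x) (comul h) = h;
  comul1 : comul 1 = tens 1 1;
  comulM : forall x y, comul (x * y) = tmul (comul x) (comul y);
  counit1 : counit 1 = 1;
  counitM : forall x y, counit (x * y) = counit x * counit y;
  antipodel : forall h,
    tlift (fun x y => antipode x * y) (comul h) = counit h *: 1;
  antipoder : forall h,
    tlift (fun x y => x * antipode y) (comul h) = counit h *: 1
}.

Arguments comul {k h0}.
Arguments counit {k h0}.
Arguments antipode {k h0}.

Section Convolution.
Variables (k : fieldType) (H : hopfType k).

(* End_k(H) with the convolution product instead of composition.              *)
Definition conv_end := 'End(H).
HB.instance Definition _ := Vector.on conv_end.
Implicit Types f g m : conv_end.

Definition convolution f g : conv_end :=
  linfun (fun h : H => tlift (fun x y : H => (f x * g y : H)) (comul h)).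
Definition conv_unit : conv_end := linfun (fun h : H => counit h *: (1 : H)).

Lemma convolutionE f g h :
  convolution f g h = tlift (fun x y => f x * g y) (comul h).
Proof.
rewrite /convolution.
set F := (fun h : H => _).
have lF : linear F by move=> a x y; rewrite /F !linearP.
pose M := GRing.isLinear.Build k H H *:%R F lF.
pose Fl : {linear H -> H} := HB.pack F M.
exact: (lfunE Fl).
Qed.

Lemma conv_unitE h : conv_unit h = counit h *: 1.
Proof.
rewrite /conv_unit.
set F := (fun h : H => _).
have lF : linear F by move=> a x y; rewrite /F !linearP /= scalerDl scalerA.
pose M := GRing.isLinear.Build k H H *:%R F lF.
pose Fl : {linear H -> H} := HB.pack F M.
exact: (lfunE Fl).
Qed.

Lemma convolutionA : associative convolution.
Proof.
move=> f g m; apply/lfunP => h; rewrite !convolutionE.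
have lin z : linear (fun x : H => x * z).
  by move=> a u v; rewrite mulrDl scalerAl.
pose M z := GRing.isLinear.Build k H H *:%R (fun x : H => x * z) (lin z).
pose linM z : {linear H -> H} := HB.pack (fun x : H => x * z) (M z).
pose T := tlift (fun (x : H) (t : tensor H H) =>
  f x * tlift (fun a b => g a * m b) t).
have Ttens x t : T (tens x t) = f x * tlift (fun a b => g a * m b) t.
  rewrite /T tlift_tens // => [y a u v|y a u v].
    by rewrite linearP /= mulrDl -scalerAl.
  by rewrite linearP /= mulrDr -scalerAr.
transitivity (T (tmap id comul (comul h))).
  rewrite /tmap [T _]linear_tlift; apply: eq_tlift => x y /=.
  by rewrite convolutionE -/(T _) Ttens.
rewrite -comulA /tmap [tassoc _]linear_tlift [T _]linear_tlift.
apply: eq_tlift => x y /=.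
rewrite -/(tassoc _) tassoc_tens /T linear_tlift convolutionE.
rewrite [RHS](linear_tlift (linM (m y))); apply: eq_tlift => a b /=.
rewrite -/(T _) Ttens tlift_tens ?mulrA // => c d u v.
  by rewrite linearP /= mulrDl -scalerAl.
by rewrite linearP /= mulrDr -scalerAr.
Qed.

Lemma convolution1l : left_id conv_unit convolution.
Proof.
move=> f; apply/lfunP => h; rewrite convolutionE.
rewrite -[in RHS](comul_counitl h) linear_tlift; apply: eq_tlift => x y /=.
by rewrite conv_unitE linearZ /= -scalerAl mul1r.
Qed.

Lemma convolution1r : right_id conv_unit convolution.
Proof.
move=> f; apply/lfunP => h; rewrite convolutionE.
rewrite -[in RHS](comul_counitr h) linear_tlift; apply: eq_tlift => x y /=.
by rewrite conv_unitE linearZ /= -scalerAr mulr1.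
Qed.

Lemma convolutionDl : left_distributive convolution +%R.
Proof.
move=> f g m; apply/lfunP => h; rewrite add_lfunE !convolutionE /tlift.
rewrite -big_split; apply: eq_bigr => i _; rewrite -big_split.
by apply: eq_bigr => j _ /=; rewrite add_lfunE mulrDl scalerDr.
Qed.

Lemma convolutionDr : right_distributive convolution +%R.
Proof.
move=> f g m; apply/lfunP => h; rewrite add_lfunE !convolutionE /tlift.
rewrite -big_split; apply: eq_bigr => i _; rewrite -big_split.
by apply: eq_bigr => j _ /=; rewrite add_lfunE mulrDr scalerDr.
Qed.

Lemma conv_unit_neq0 : conv_unit != 0.
Proof.
apply/eqP => /lfunP/(_ 1); rewrite conv_unitE zero_lfunE counit1 scale1r.
by apply/eqP; rewrite oner_eq0.
Qed.

HB.instance Definition _ := GRing.Zmodule_isNzRing.Build conv_end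
  convolutionA convolution1l convolution1r convolutionDl convolutionDr
  conv_unit_neq0.

Lemma convolutionZl a f g : a *: (f * g) = (a *: f) * g.
Proof.
apply/lfunP => h; rewrite scale_lfunE !convolutionE /tlift scaler_sumr.
apply: eq_bigr => i _; rewrite scaler_sumr; apply: eq_bigr => j _ /=.
by rewrite scale_lfunE -scalerAl !scalerA mulrC.
Qed.

Lemma convolutionZr a f g : a *: (f * g) = f * (a *: g).
Proof.
apply/lfunP => h; rewrite scale_lfunE !convolutionE /tlift scaler_sumr.
apply: eq_bigr => i _; rewrite scaler_sumr; apply: eq_bigr => j _ /=.
by rewrite scale_lfunE -scalerAr !scalerA mulrC.
Qed.

HB.instance Definition _ := GRing.Lmodule_isLalgebra.Build k conv_end convolutionZl.
HB.instance Definition _ := GRing.Lalgebra_isAlgebra.Build k conv_end convolutionZr.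
HB.instance Definition _ := Algebra_isFalgebra.Build k conv_end.

Definition conv_id : conv_end := \1%VF.

(* Negative powers are powers of the convolution inverse, i.e. the antipode:  *)
(* see conv_idV.                                                              *)
Definition hopf_pow (n : int) : 'End(H) := conv_id ^ n.

Definition lftrace (V : vectType k) (f : 'End(V)) : k :=
  \tr (passmx.mxof (vbasis {:V}) (vbasis {:V}) f).

Definition nu (n : int) : k := lftrace (antipode \o hopf_pow (n - 1))%VF.

Definition left_integral (L : H) : Prop := forall h : H, h * L = counit h *: L.

Lemma conv_idV : conv_id^-1 = antipode :> conv_end.
Proof.
have SI : (antipode : conv_end) * conv_id = 1.
  apply/lfunP => h; rewrite convolutionE conv_unitE -antipodel.
  by apply: eq_tlift => x y; rewrite id_lfunE.
have IS : conv_id * (antipode : conv_end) = 1.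
  apply/lfunP => h; rewrite convolutionE conv_unitE -antipoder.
  by apply: eq_tlift => x y; rewrite id_lfunE.
have U : conv_id \is a GRing.unit by apply/unitrP; exists antipode.
by apply: (mulrI U); rewrite mulrV // IS.
Qed.

Lemma hopf_powN2 h :
  hopf_pow (-2) h = tlift (fun x y => antipode x * antipode y) (comul h).
Proof.
by rewrite /hopf_pow -invr_expz -exprVn conv_idV expr2 convolutionE.
Qed.

End Convolution.

(* Main.v *)
(* As L is a left integral, L_(1) (x) h L_(2) = S(h) L_(1) (x) L_(2). From    *)
(* this and S(x_(1)) x_(2) = eps(x) one gets that comul L is a nondegenerate  *)
(* tensor, without assuming S bijective. Hence mu(L_(1)) L_(2) = 1 for some   *)
(* functional mu, so a = mu(S(a) L_(1)) L_(2) and S is injective. Now choose  *)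
(* lam with L_(1) lam(L_(2)) = 1: then S(a) = L_(1) lam(a L_(2)), whence S is *)
(* antimultiplicative, S(L) is a right integral,                              *)
(* S(S(L)) = L_(1) lam(S(L) L_(2)) = lam(S(L)) L, and                         *)
(* Tr(S o g) = lam(g(L_(1)) L_(2)). For g = P^(-2) the right-hand side is     *)
(* lam(P^(-1)(L)) = lam(S(L)).                                                *)
Require Import Defs.
From HB Require Import structures.
From mathcomp Require Import all_boot all_order all_algebra all_field.
Import GRing.Theory.
Local Open Scope ring_scope.

(** Both scalars equal [lam (antipode L)], where [lam] satisfies L_(1) lam(L_(2)) = 1. Such a [lam]
    exists because [comul L] is nondegenerate ([comul_integral_unitmx]), and [integral_shift] then
    yields S(a) = L_(1) lam(a L_(2)) ([antipode_integral]). At a = S(L), a right integral, this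
    formula computes S(S(L)); read as a sum of rank-one maps, it computes the trace of S composed
    with any endomorphism, hence [nu H (-1)]. *)

Section HopfAlgebra.
Set Implicit Arguments.
Unset Strict Implicit.
Variables (k : fieldType) (H : hopfType k).
Implicit Types h L : H.
Local Notation e := (vbasis {:H}).

(** * Sweedler calculus and coordinates *)

Lemma scalar_tlift (U V : vectType k) (W : lmodType k) (T : {scalar W})
    (f : U -> V -> W) t :
  T (tlift f t) = tlift (fun u v => T (f u v) : k^o) t.
Proof.
rewrite linear_sum; apply: eq_bigr => i _; rewrite linear_sum.
by apply: eq_bigr => j _; rewrite linearZ.
Qed.

Lemma tlift_fun_linear (U V : vectType k) (W : lmodType k) a
    (f g m : U -> V -> W) t :
  (forall x y, m x y = a *: f x y + g x y) ->
  tlift m t = a *: tlift f t + tlift g t.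
Proof.
move=> fgm; rewrite /tlift scaler_sumr -big_split; apply: eq_bigr => i _.
rewrite scaler_sumr -big_split; apply: eq_bigr => j _ /=.
by rewrite fgm scalerDr !scalerA mulrC.
Qed.

(** Coassociativity as used in Sweedler computations: both sides are the map induced by the
    trilinear [G], applied to the two sides of [comulA]. *)
Lemma tlift_comulA (W : lmodType k) (G : H -> H -> H -> W) h :
    (forall b c, linear (fun a => G a b c)) ->
    (forall a c, linear (fun b => G a b c)) ->
    (forall a b, linear (G a b)) ->
  tlift (fun u v => tlift (G u) (comul v)) (comul h) =
  tlift (fun u v => tlift (fun a b => G a b v) (comul u)) (comul h).
Proof.
move=> G1 G2 G3.
pose T := tlift (fun (x : H) (t : tensor H H) => tlift (G x) t).
have Ttens x t : T (tens x t) = tlift (G x) t.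
  rewrite /T tlift_tens // => [y a u v|y a u v]; last exact: linearP.
  by apply: tlift_fun_linear => *; rewrite G1.
transitivity (T (tmap id comul (comul h))).
  rewrite /tmap [T _]linear_tlift; apply: eq_tlift => x y /=.
  by rewrite -/(T _) Ttens.
rewrite -comulA /tmap [tassoc _]linear_tlift [T _]linear_tlift.
apply: eq_tlift => x y /=.
rewrite -/(tassoc _) tassoc_tens /T linear_tlift.
apply: eq_tlift => a b /=.
by rewrite -/(T _) Ttens tlift_tens.
Qed.

Lemma counit_antipode h : counit (antipode h) = counit h.
Proof.
transitivity (counit (tlift (fun x y => antipode x * y) (comul h))).
  rewrite -[in LHS](comul_counitr h) (linear_tlift antipode) !scalar_tlift.
  apply: (@eq_tlift k H H k^o) => x y.
  by rewrite linearZ /= linearZ /= counitM mulrC.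
by rewrite antipodel linearZ /= counit1 mulr1.
Qed.

Lemma antipode_conv_id : (antipode : conv_end H) * conv_id H = 1.
Proof.
apply/lfunP => x; rewrite convolutionE conv_unitE -antipodel.
by apply: eq_tlift => a b; rewrite id_lfunE.
Qed.

Lemma lftraceE (f : 'End(H)) : lftrace f = \sum_i coord e i (f e`_i).
Proof.
apply: eq_bigr => i _; rewrite passmx.coord_rVof.
rewrite (passmx.rVof_app _ (vbasisP _)).
by rewrite (passmx.rVofE (vbasisP _)) -rowE [RHS]mxE.
Qed.

Lemma tlift_tmul (W : lmodType k) (F : H -> H -> W) (s t : tensor H H) :
    (forall y, linear (F^~ y)) -> (forall x, linear (F x)) ->
  tlift F (tmul s t) =
  tlift (fun b c => tlift (fun x y => F (b * x) (c * y)) t) s.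
Proof.
move=> F1 F2; rewrite /tmul linear_tlift; apply: eq_tlift => b c.
by rewrite [LHS]linear_tlift; apply: eq_tlift => x y /=; rewrite tlift_tens.
Qed.

Lemma scalar_basis (c : 'I_(\dim {:H}) -> k) :
  exists f : {scalar H}, forall i : 'I_(\dim {:H}), f e`_i = c i.
Proof.
pose f y := \sum_j coord e j y * c j.
have fl : scalar f.
  move=> a x y; rewrite /f mulr_sumr -big_split; apply: eq_bigr => j _ /=.
  by rewrite linearP mulrDl mulrA.
pose fL : {scalar H} := HB.pack f (GRing.isLinear.Build k H k *%R f fl).
exists fL => i; rewrite /= /f (bigD1 i) //=.
rewrite coord_free ?(basis_free (vbasisP _)) // eqxx mul1r.
rewrite big1 ?addr0 // => j ji.
by rewrite coord_free ?(basis_free (vbasisP _)) // eq_sym (negPf ji) mul0r.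
Qed.

Lemma tlift_scaler (f : H -> k) (t : tensor H H) i :
  coord e i (tlift (fun x y => f y *: x) t) = \sum_j t i j * f e`_j.
Proof.
have -> : tlift (fun x y => f y *: x) t =
    \sum_l (\sum_j t l j * f e`_j) *: e`_l.
  by apply: eq_bigr => l _; rewrite scaler_suml; apply: eq_bigr => j _;
     rewrite scalerA.
by rewrite coord_sum_free // (basis_free (vbasisP _)).
Qed.

Lemma tlift_scalel (f : H -> k) (t : tensor H H) j :
  coord e j (tlift (fun x y => f x *: y) t) = \sum_i t i j * f e`_i.
Proof.
have -> : tlift (fun x y => f x *: y) t =
    \sum_l (\sum_i t i l * f e`_i) *: e`_l.
  rewrite /tlift exchange_big; apply: eq_bigr => l _; rewrite scaler_suml.
  by apply: eq_bigr => i _; rewrite scalerA.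
by rewrite coord_sum_free // (basis_free (vbasisP _)).
Qed.

Lemma eq_coord_vbasis (x y : H) :
  (forall i, coord e i x = coord e i y) -> x = y.
Proof.
move=> xy; rewrite (coord_vbasis (memvf x)) (coord_vbasis (memvf y)).
by apply: eq_bigr => i _; rewrite xy.
Qed.

(** * Nondegeneracy of the coproduct of a left integral *)

Section Integral.
Variables (L : H) (hL : left_integral L).

(** Inserting S(h_(1)) h_(2) before L_(1) creates comul(h_(2) L), which collapses to eps(h_(2))
    comul(L). *)
Lemma integral_shift (W : lmodType k) (F : H -> H -> W) h :
    (forall y, linear (F^~ y)) -> (forall x, linear (F x)) ->
  tlift (fun x y => F x (h * y)) (comul L) =
  tlift (fun x y => F (antipode h * x) y) (comul L).
Proof.
move=> F1 F2.
pose R z v := tlift (fun x y => F (z * x) (v * y)) (comul L).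
have R1 v : linear (R^~ v).
  by move=> a z w; apply: tlift_fun_linear => x y; rewrite mulrDl -scalerAl F1.
have R2 z : linear (R z).
  by move=> a v w; apply: tlift_fun_linear => x y; rewrite mulrDl -scalerAl F2.
pose Rl v : {linear H -> W} :=
  HB.pack (R^~ v) (GRing.isLinear.Build k H W *:%R (R^~ v) (R1 v)).
pose Rr z : {linear H -> W} :=
  HB.pack (R z) (GRing.isLinear.Build k H W *:%R (R z) (R2 z)).
have RZl a z v : R (a *: z) v = a *: R z v := linearZ_LR (Rl v) a z.
have RZr a z v : R z (a *: v) = a *: R z v := linearZ_LR (Rr z) a v.
transitivity (Rr 1 h); first by apply: eq_tlift => x y; rewrite mul1r.
transitivity (Rl 1 (antipode h)); last by apply: eq_tlift => x y; rewrite mul1r.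
rewrite -[in LHS](comul_counitl h) -[in RHS](comul_counitr h).
rewrite (linear_tlift (Rr 1)) (linear_tlift antipode) (linear_tlift (Rl 1)) /=.
(* Both sides are F applied to S(h_(1)) h_(2) L_(1) (x) h_(3) L_(2).          *)
transitivity (tlift (fun u v =>
    tlift (fun a b => R (antipode a * b) v) (comul u)) (comul h)).
  apply: eq_tlift => u v; rewrite -[RHS](linear_tlift (Rl v)) antipodel.
  by rewrite /= RZl RZr.
rewrite -(tlift_comulA (G := fun a b v => R (antipode a * b) v)).
- apply: eq_tlift => u v; rewrite linearZ /= RZl.
  transitivity (tlift (fun x y => F (antipode u * x) y) (comul (v * L))).
    rewrite comulM tlift_tmul => [|y|x]; last exact: F2; last first.
      by move=> a b c; rewrite mulrDr -scalerAr F1.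
    by do 2!apply: eq_tlift => ? ?; rewrite mulrA.
  rewrite hL !linearZ; congr (_ *: _).
  by apply: eq_tlift => x y; rewrite mul1r.
- by move=> b c a u v; rewrite linearP mulrDl -scalerAl R1.
- by move=> a c b u v; rewrite mulrDr -scalerAr R1.
- by move=> a b; apply: R2.
Qed.

Hypothesis L_neq0 : L != 0.

(* With p(x) = coord e i x nonzero at L, nondegeneracy rests on the identity  *)
(* p(L_(1)) S(L_(2)) L_(3) = p(L) 1, i.e. (p 1) * S * id = p 1 in conv_end H. *)
Lemma comul_integral_inj (g : {scalar H}) :
  tlift (fun x y => g y *: x) (comul L) = 0 -> forall h, g h = 0.
Proof.
move=> g0 h.
(* The vanishing persists after multiplying L_(2) by [a]: the shift turns [a] into a left factor
   S(a). *)
have gM a : tlift (fun x y => g (a * y) *: x) (comul L) = 0.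
  rewrite (integral_shift (F := fun x y => g y *: x)) => [|y b u v|x b u v].
  - transitivity (amull (antipode a) (tlift (fun x y => g y *: x) (comul L))).
      rewrite linear_tlift; apply: eq_tlift => x y.
      by rewrite linearZ /= lfunE.
    by rewrite g0 linear0.
  - by rewrite scalerDr !scalerA mulrC.
  - by rewrite linearP scalerDl scalerA.
have gMi a i : \sum_j comul L i j * g (a * e`_j) = 0.
  by rewrite -(tlift_scaler (fun y => g (a * y))) gM linear0.
have [i Li] : exists i, coord e i L != 0.
  apply/existsP; apply: contraR L_neq0; rewrite negb_exists => /forallP L0.
  apply/eqP/eq_coord_vbasis => i; rewrite linear0; apply/eqP.
  by rewrite -[_ == _]negbK.
pose f0 x := coord e i x *: (1 : H).
have f0_lin : linear f0.
  by move=> a x y; rewrite /f0 linearP scalerDl scalerA.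
pose f0L : {linear H -> H} :=
  HB.pack f0 (GRing.isLinear.Build k H H *:%R f0 f0_lin).
pose f : conv_end H := linfun f0L.
pose q : conv_end H := f * (antipode : conv_end H).
have qK : tlift (fun x y => q x * y) (comul L) = coord e i L *: 1.
  have <- : f L = coord e i L *: 1 by rewrite [f L](lfunE f0L).
  rewrite -[f]mulr1 -antipode_conv_id mulrA [RHS]convolutionE.
  by apply: eq_tlift => x y; rewrite [conv_id H y]id_lfunE.
apply: (mulfI Li); rewrite mulr0 -[h in LHS]mulr1.
transitivity (g (amull h (coord e i L *: 1))).
  by rewrite lfunE /= -scalerAr linearZ.
(* This is g(h q(L_(1)) L_(2)); for each basis vector in the first leg, [gMi] with a = h q(e_l)
   kills the sum. *)
rewrite -qK linear_tlift scalar_tlift; apply: big1 => l _.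
transitivity (\sum_j comul L l j * g (h * q e`_l * e`_j)); last exact: gMi.
by apply: eq_bigr => j _; rewrite /= lfunE /= mulrA.
Qed.

Lemma comul_integral_unitmx : (comul L : 'M_(\dim {:H})) \in unitmx.
Proof.
rewrite -unitmx_tr -row_free_unit; apply: inj_row_free => v vL.
have [g gE] := scalar_basis (v 0).
apply/rowP => i; rewrite mxE -gE; apply: comul_integral_inj.
apply: eq_coord_vbasis => j; rewrite linear0 tlift_scaler.
transitivity ((v *m (comul L : 'M_(\dim {:H}))^T) 0 j); last by rewrite vL mxE.
rewrite [RHS]mxE; apply: eq_bigr => l _.
by rewrite gE mxE mulrC.
Qed.

Lemma integral_dualr :
  exists lam : {scalar H}, tlift (fun x y => lam y *: x) (comul L) = 1.
Proof.
pose v := invmx (comul L : 'M_(\dim {:H})) *m \col_i coord e i 1.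
have [lam lamE] := scalar_basis (v^~ 0).
exists lam; apply: eq_coord_vbasis => i; rewrite tlift_scaler.
have /colP/(_ i) := mulKVmx comul_integral_unitmx (\col_i coord e i 1).
rewrite -/v !mxE => <-.
by apply: eq_bigr => j _; rewrite lamE.
Qed.

(** Injectivity was proved for functionals on the second leg only; as the coordinate matrix is
    square, its inverse serves the first leg too. *)
Lemma integral_duall :
  exists mu : {scalar H}, tlift (fun x y => mu x *: y) (comul L) = 1.
Proof.
pose v := (\row_i coord e i 1) *m invmx (comul L : 'M_(\dim {:H})).
have [mu muE] := scalar_basis (v 0).
exists mu; apply: eq_coord_vbasis => j; rewrite tlift_scalel.
have /rowP/(_ j) := mulmxKV comul_integral_unitmx (\row_i coord e i 1).
rewrite -/v !mxE => <-.
by apply: eq_bigr => i _; rewrite muE mulrC.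
Qed.

Lemma antipode_inj : injective (antipode : H -> H).
Proof.
have [mu mu1] := integral_duall.
have S0 (a : H) : antipode a = 0 -> a = 0.
  move=> Sa.
  transitivity (amull a (tlift (fun x y => mu x *: y) (comul L))).
    by rewrite mu1 lfunE /= mulr1.
  rewrite linear_tlift.
  transitivity (tlift (fun x y => mu x *: (a * y)) (comul L)).
    by apply: eq_tlift => x y; rewrite linearZ /= lfunE.
  rewrite (integral_shift (F := fun x y => mu x *: y)) => [|y b u v|x b u v].
  - apply: big1 => i _; apply: big1 => j _.
    by rewrite Sa mul0r linear0 scale0r scaler0.
  - by rewrite linearP scalerDl scalerA.
  - by rewrite scalerDr !scalerA mulrC.
by move=> a b Sab; apply/subr0_eq/S0; rewrite linearB /= Sab subrr.
Qed.

(** * The antipode expressed through the dual functional *)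

Section Dual.
Variable lam : {scalar H}.
Hypothesis lam1 : tlift (fun x y => lam y *: x) (comul L) = 1.

Lemma antipode_integral (a : H) :
  antipode a = tlift (fun x y => lam (a * y) *: x) (comul L).
Proof.
rewrite (integral_shift (F := fun x y => lam y *: x)) => [|y b u v|x b u v].
- transitivity (amull (antipode a) (tlift (fun x y => lam y *: x) (comul L))).
    by rewrite lam1 lfunE /= mulr1.
  by rewrite linear_tlift; apply: eq_tlift => x y; rewrite linearZ /= lfunE.
- by rewrite scalerDr !scalerA mulrC.
- by rewrite linearP scalerDl scalerA.
Qed.

(** In L_(1) lam(a b L_(2)), shifting [b] alone pulls S(b) out on the left and leaves the formula
    for S(a). *)
Lemma antipodeM (a b : H) : antipode (a * b) = antipode b * antipode a.
Proof.
rewrite antipode_integral.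
transitivity (tlift (fun x y => lam (a * (b * y)) *: x) (comul L)).
  by apply: eq_tlift => x y; rewrite mulrA.
rewrite (integral_shift (F := fun x y => lam (a * y) *: x))
  => [|y c u v|x c u v].
- rewrite [in RHS](antipode_integral a).
  transitivity (amull (antipode b)
    (tlift (fun x y => lam (a * y) *: x) (comul L))); last by rewrite lfunE.
  by rewrite linear_tlift; apply: eq_tlift => x y; rewrite linearZ /= lfunE.
- by rewrite scalerDr !scalerA mulrC.
- by rewrite mulrDr -scalerAr linearP scalerDl scalerA.
Qed.

(** By finite dimension the injective S is onto, so h = S(h') and S(L) S(h') = S(h' L). *)
Lemma antipode_integral_right h : antipode L * h = counit h *: antipode L.
Proof.
have /lker0P kerS := antipode_inj.
rewrite -[h](lker0_lfunVK kerS) -antipodeM hL linearZ /=.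
by rewrite counit_antipode.
Qed.

(** S(g(x)) = L_(1) lam(g(x) L_(2)), and a rank-one map x -> phi(x) u has trace phi(u). *)
Lemma lftrace_antipode (g : 'End(H)) :
  lftrace (antipode \o g)%VF = lam (tlift (fun x y => g x * y) (comul L)).
Proof.
rewrite lftraceE scalar_tlift; apply: eq_bigr => i _.
by rewrite comp_lfunE antipode_integral tlift_scaler.
Qed.

Lemma nuN1 : nu H (-1) = lam (antipode L).
Proof.
rewrite /nu lftrace_antipode; congr (lam _).
transitivity (((hopf_pow H (-1 - 1) : conv_end H) * conv_id H) L).
  by rewrite [RHS]convolutionE; apply: eq_tlift => x y; rewrite id_lfunE.
(* The convolution power is S * S, and one factor S cancels against the identity. *)
rewrite /hopf_pow -opprD -invr_expz -exprVn conv_idV expr2 -mulrA.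
by rewrite antipode_conv_id mulr1.
Qed.

Lemma antipode_sqr_integral : antipode (antipode L) = lam (antipode L) *: L.
Proof.
rewrite antipode_integral -[X in _ = _ *: X]comul_counitr.
transitivity (tlift (fun x y =>
    lam (antipode L) *: (counit y *: x)) (comul L)).
  apply: eq_tlift => x y.
  by rewrite antipode_integral_right linearZ /= scalerA mulrC.
rewrite /tlift scaler_sumr; apply: eq_bigr => i _; rewrite scaler_sumr.
by apply: eq_bigr => j _; rewrite !scalerA mulrCA mulrA.
Qed.

End Dual.

End Integral.
End HopfAlgebra.

Theorem proposition3p13 (k : fieldType) (H : hopfType k) (L : H)
    (hL : left_integral L) (L_neq0 : L != 0) :
  antipode (antipode L) = nu H (-1) *: L.
Proof.
have [lam lam1] := integral_dualr hL L_neq0.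
by rewrite (nuN1 hL lam1) (antipode_sqr_integral hL L_neq0 lam1).
Qed.
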